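(* Let $\mathbb F$ be a finite field and let $\mathcal Z$ be the universal cubic space over $\mathbb F$. The category $\mathrm{Tra}(\mathrm{Isoc}(\mathcal Z))$ is equivalent to the following category: its objects are finite-dimensional cubic spaces over $\mathbb F$; a morphism $V\to W$ is an isocubic linear bijection of a linear subspace $A\subset V$ onto a linear subspace $B\subset W$ (composition is the product of partial bijections).
   Context: A cubic space over $\mathbb F$ is a linear space $V$ over $\mathbb F$ with a symmetric trilinear form $\varpi_V:V\times V\times V\to\mathbb F$; subspaces carry the restricted form. An isocubic embedding is an injective linear map preserving the trilinear forms; an isocubic linear bijection is a linear bijection preserving the forms. $\mathrm{Isoc}(V)$ is the group of isocubic linear bijections $V\to V$. The universal cubic space $\mathcal Z$ is the cubic space of countably infinite dimension over $\mathbb F$ (it exists and is unique up to isomorphism) with the Urysohn extension property: for any finite-dimensional cubic space $W$ and any subspace $V\subset W$ of codimension $1$, any isocubic embedding $V\to\mathcal Z$ extends to an isocubic embedding $W\to\mathcal Z$. The group $K=\mathrm{Isoc}(\mathcal Z)$ is regarded as a closed subgroup of the group $S(\mathcal Z)$ of all permutations of the countable set $\mathcal Z$. A partial bijection $\mu:X\to Y$ is a bijection from a subset $\mathrm{dom}\,\mu\subset X$ onto a subset $\mathrm{im}\,\mu\subset Y$. The product of $\mu:X\to Y$ and $\nu:Y\to Z$ is the partial bijection $\nu\mu$ with $\mathrm{dom}\,\nu\mu=\mu^{-1}(\mathrm{dom}\,\nu\cap\mathrm{im}\,\mu)$ and $\nu\mu(x)=\nu(\mu(x))$. For a group $K\subset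 S(\Omega)$ and finite $A\subset\Omega$, let $K(A)$ be the pointwise stabilizer of $A$ in $K$; a finite set $A\subset\Omega$ is perfect if all orbits of $K(A)$ on $\Omega\setminus A$ are infinite. For perfect $A,B$ and $g\in K$, $g|_{A\to B}$ is the partial bijection $A\to B$ with domain $A\cap g^{-1}B$ given there by $g$. The category $\mathrm{Tra}(K)$ has the perfect subsets of $\Omega$ as objects and the partial bijections of the form $g|_{A\to B}$, $g\in K$, as morphisms $A\to B$; composition is the product of partial bijections. Here it is applied to $K=\mathrm{Isoc}(\mathcal Z)$, $\Omega=\mathcal Z$. *)

(* Defs.v *)
From HB Require Import structures.
From mathcomp Require Import all_boot all_order all_algebra.
From mathcomp Require Import finmap boolp classical_sets cardinality.
Set Implicit Arguments.
Unset Strict Implicit.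
Unset Printing Implicit Defensive.
Import GRing.Theory.
Local Open Scope ring_scope.
Local Open Scope classical_set_scope.

Record category := Category {
  obj :> Type;
  hom : obj -> obj -> Type;
  idm : forall a, hom a a;
  comp : forall a b c, hom b c -> hom a b -> hom a c;
  comp_idl : forall a b (f : hom a b), comp (idm b) f = f;
  comp_idr : forall a b (f : hom a b), comp f (idm a) = f;
  comp_assoc : forall a b c d (h : hom c d) (g : hom b c) (f : hom a b),
    comp h (comp g f) = comp (comp h g) f }.
Arguments hom {C} : rename.
Arguments idm {C} : rename.
Arguments comp {C a b c} : rename.

Definition is_iso (C : category) (a b : C) (f : hom a b) : Prop :=
  exists g : hom b a, comp g f = idm a /\ comp f g = idm b.

Record functor (C D : category) := Functor {
  fobj :> C -> D;
  fmap : forall a b, hom a b -> hom (fobj a) (fobj b);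
  fmap_id : forall a, fmap (idm a) = idm (fobj a);
  fmap_comp : forall a b c (g : hom b c) (f : hom a b),
    fmap (comp g f) = comp (fmap g) (fmap f) }.

Definition functor_id (C : category) : functor C C :=
  @Functor C C id (fun _ _ f => f) (fun _ => erefl) (fun _ _ _ _ _ => erefl).

Section FunctorComp.
Variables (C D E : category) (G : functor D E) (F : functor C D).

Lemma functor_comp_id (a : C) : fmap G (fmap F (idm a)) = idm (G (F a)).
Proof. by rewrite !fmap_id. Qed.

Lemma functor_comp_comp (a b c : C) (g : hom b c) (f : hom a b) :
  fmap G (fmap F (comp g f)) = comp (fmap G (fmap F g)) (fmap G (fmap F f)).
Proof. by rewrite !fmap_comp. Qed.

Definition functor_comp : functor C E :=
  @Functor C E (fun a => G (F a)) (fun a b f => fmap G (fmap F f))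
    functor_comp_id functor_comp_comp.

End FunctorComp.

Definition naturally_isomorphic (C D : category) (F G : functor C D) : Prop :=
  exists eta : forall a, hom (F a) (G a),
    (forall a, is_iso (eta a)) /\
    (forall a b (f : hom a b), comp (eta b) (fmap F f) = comp (fmap G f) (eta a)).

Definition equivalent_categories (C D : category) : Prop :=
  exists (F : functor C D) (G : functor D C),
    naturally_isomorphic (functor_comp G F) (functor_id C) /\
    naturally_isomorphic (functor_comp F G) (functor_id D).

(* The domain of [mu] is the set of [x] with [mu x <> None]. *)
Record pbij (X Y : Type) := PBij {
  pfun :> X -> option Y;
  pfun_inj : forall x x' y, pfun x = Some y -> pfun x' = Some y -> x = x' }.

Lemma pbij_eq (X Y : Type) (mu nu : pbij X Y) : pfun mu =1 pfun nu -> mu = nu.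
Proof.
case: mu nu => [f fI] [g gI] /= /funext fg; subst g.
by rewrite (Prop_irrelevance fI gI).
Qed.

Lemma pbij_id_inj (X : Type) (x x' y : X) : Some x = Some y -> Some x' = Some y -> x = x'.
Proof. by move=> [->] [->]. Qed.

Definition pbij_id (X : Type) : pbij X X := PBij (@pbij_id_inj X).

Section PbijComp.
Variables (X Y Z : Type) (nu : pbij Y Z) (mu : pbij X Y).

Lemma pbij_comp_inj x x' z :
  obind nu (mu x) = Some z -> obind nu (mu x') = Some z -> x = x'.
Proof.
case E : (mu x) => [y|] //=; case E' : (mu x') => [y'|] //= Hy Hy'.
by move: E; rewrite (pfun_inj Hy Hy') => E; exact: pfun_inj E E'.
Qed.

Definition pbij_comp : pbij X Z := PBij pbij_comp_inj.

End PbijComp.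

Section PbijCategory.
Variables (T : Type) (car : T -> Type).
Variable P : forall a b, pbij (car a) (car b) -> Prop.
Hypothesis Pid : forall a, P (pbij_id (car a)).
Hypothesis Pcomp : forall a b c (nu : pbij (car b) (car c))
  (mu : pbij (car a) (car b)), P nu -> P mu -> P (pbij_comp nu mu).

Definition pbij_hom a b := {mu : pbij (car a) (car b) | P mu}.

Definition pbij_hom_id a : pbij_hom a a := exist _ _ (Pid a).

Definition pbij_hom_comp a b c (nu : pbij_hom b c) (mu : pbij_hom a b) :
  pbij_hom a c := exist _ _ (Pcomp (proj2_sig nu) (proj2_sig mu)).

Lemma pbij_hom_eq a b (mu nu : pbij_hom a b) :
  pfun (proj1_sig mu) =1 pfun (proj1_sig nu) -> mu = nu.
Proof.
case: mu nu => [f fP] [g gP] /= /pbij_eq fg; subst g.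
by rewrite (Prop_irrelevance fP gP).
Qed.

Lemma pbij_hom_idl a b (f : pbij_hom a b) : pbij_hom_comp (pbij_hom_id b) f = f.
Proof. by apply: pbij_hom_eq => x /=; case: (proj1_sig f x). Qed.

Lemma pbij_hom_idr a b (f : pbij_hom a b) : pbij_hom_comp f (pbij_hom_id a) = f.
Proof. exact: pbij_hom_eq. Qed.

Lemma pbij_hom_assoc a b c d (h : pbij_hom c d) (g : pbij_hom b c)
    (f : pbij_hom a b) :
  pbij_hom_comp h (pbij_hom_comp g f) = pbij_hom_comp (pbij_hom_comp h g) f.
Proof. by apply: pbij_hom_eq => x /=; case: (proj1_sig f x). Qed.

Definition pbij_category : category :=
  Category pbij_hom_idl pbij_hom_idr pbij_hom_assoc.

End PbijCategory.

Record permGroup (Omega : Type) := PermGroup {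
  pg_set :> (Omega -> Omega) -> Prop;
  pg_bij : forall g, pg_set g -> bijective g;
  pg_id : pg_set id;
  pg_comp : forall g h, pg_set g -> pg_set h -> pg_set (g \o h);
  pg_inv : forall g h, pg_set g -> cancel g h -> cancel h g -> pg_set h }.

Section Tra.
Variables (Omega : choiceType) (K : permGroup Omega).

Definition pstab (A : {fset Omega}) : set (Omega -> Omega) :=
  [set g | K g /\ forall a, a \in A -> g a = a].

Definition perfect (A : {fset Omega}) : Prop :=
  forall x, x \notin A -> infinite_set [set g x | g in pstab A].

(* [insub] restricts the values to B: this is g|_{A -> B}, with domain the
   intersection of A and g^-1 B. *)
Definition tra_morphism (A B : {fset Omega}) (mu : pbij A B) : Prop :=
  exists2 g, K g & forall a : A, mu a = insub (g (val a)).

Lemma pg_inj g : K g -> injective g.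
Proof. by move/(@pg_bij _ K)/bij_inj. Qed.

Lemma pstab_inv A g : pstab A g -> exists h, [/\ pstab A h, cancel g h & cancel h g].
Proof.
move=> [Kg gA]; have [h gK hK] := pg_bij Kg; exists h; split=> //; split.
  exact: pg_inv Kg gK hK.
by move=> a aA; rewrite -{1}(gA a aA) gK.
Qed.

Lemma pstab_comp A g h : pstab A g -> pstab A h -> pstab A (g \o h).
Proof.
move=> [Kg gA] [Kh hA]; split; first exact: pg_comp.
by move=> a aA /=; rewrite hA // gA.
Qed.

(* P. M. Neumann's separation lemma, in a form suited to induction on [P]. *)
Lemma neumann_avoid (A : {fset Omega}) : perfect A ->
  forall (P : seq Omega) (T : seq (Omega * Omega)), all [pred p | p \notin A] P ->
    (forall t, t \in T -> t.1 \in P) ->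
    exists2 g, pstab A g & forall t, t \in T -> g t.1 <> t.2.
Proof.
move=> pA; elim=> [|p P IH] T /= PA TP.
  exists id; last by move=> t /TP.
  by split=> //; exact: pg_id.
have /andP[pnA {}PA] := PA.
pose Q := [seq t.2 | t <- T]; pose T' := [seq t <- T | t.1 \in P].
have [y Hy yQ] : exists2 y, pstab A y & y p \notin Q.
  apply: contrapT => nex; apply: (pA p pnA).
  apply: (@sub_finite_set _ _ [set` Q]); last exact: finite_seq.
  move=> _ [g Hg <-] /=; apply: contrapT => /negP gQ.
  by apply: nex; exists g.
have [y' [Hy' yK y'K]] := pstab_inv Hy.
have [x Hx] : exists x : Omega -> Omega -> Omega, forall q, pstab A (x q) /\
    ((exists2 g, pstab A g & g p = q) -> x q p = q).
  suff /choice[x Hx] : forall q, exists xq, pstab A xq /\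
    ((exists2 g, pstab A g & g p = q) -> xq p = q) by exists x.
  move=> q.
  have [[g Hg gq]|n] := pselect (exists2 g, pstab A g & g p = q); first by exists g.
  by exists id; split=> //; split=> //; exact: pg_id.
pose T'' := T' ++ [seq (t.1, x q (y' t.2)) | q <- Q, t <- T'].
have [t|g Hg gT] := IH T'' PA.
  rewrite mem_cat mem_filter => /orP[/andP[] //|/allpairsP[[q s] /= [_ sT ->]]] /=.
  by move: sT; rewrite mem_filter => /andP[].
have gT' t : t \in T' -> g t.1 <> t.2.
  by move=> tT; apply: gT; rewrite mem_cat tT.
have [gpQ|gpQ] := boolP (g p \in Q); last first.
  exists g => // t tT; have := TP _ tT; rewrite inE => /orP[/eqP tp|tP].
    move=> e; move/negP: gpQ; apply; rewrite -tp e; exact: map_f.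
  by apply: gT'; rewrite mem_filter tP.
have [Hx1 /(_ (ex_intro2 _ _ g Hg erefl)) Hx2] := Hx (g p).
have [x' [Hx' xK x'K]] := pstab_inv Hx1.
exists (y \o (x' \o g)); first by apply: pstab_comp => //; apply: pstab_comp.
move=> t tT /=; have := TP _ tT; rewrite inE => /orP[/eqP tp|tP].
  rewrite tp -Hx2 xK => e; move/negP: yQ; apply; rewrite e; exact: map_f.
have tT' : t \in T' by rewrite mem_filter tP.
move=> e; apply: (gT (t.1, x (g p) (y' t.2))).
  rewrite mem_cat; apply/orP; right; apply/allpairsP.
  by exists (g p, t).
by rewrite /= -e yK x'K.
Qed.

Lemma tra_morphism_id (A : {fset Omega}) : tra_morphism (pbij_id A).
Proof. by exists id; [exact: pg_id|move=> a /=; rewrite valK]. Qed.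

Lemma tra_morphism_comp (A B C : {fset Omega}) (nu : pbij B C) (mu : pbij A B) :
  perfect B -> tra_morphism nu -> tra_morphism mu -> tra_morphism (pbij_comp nu mu).
Proof.
move=> pB [h Kh nuE] [g Kg muE].
have [h' hK h'K] := pg_bij Kh.
pose P := [seq x <- [seq g a | a <- A] | x \notin B].
pose Q := [seq h' c | c <- C].
have [k Kk kPQ] : exists2 k, pstab B k & forall x, x \in P -> k x \notin Q.
  have [||k Kk kT] := @neumann_avoid B pB P [seq (p, q) | p <- P, q <- Q].
  - by apply/allP => x; rewrite mem_filter => /andP[].
  - by move=> t /allpairsP[[p q] /= [pP _ ->]].
  exists k => // x xP; apply/negP => kxQ.
  by apply: (kT (x, k x)) => //; apply/allpairsP; exists (x, k x).
have [Kk1 kB] := Kk.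
exists (h \o (k \o g)); first by apply: pg_comp => //; apply: pg_comp.
move=> a /=; rewrite muE; case: insubP => [b bB bE|gaB] /=.
  by rewrite nuE bE kB.
rewrite insubN //; apply/negP => hC.
have gaP : g (val a) \in P by rewrite mem_filter gaB map_f // (valP a).
by move/negP: (kPQ _ gaP); apply; apply/mapP; exists (h (k (g (val a)))).
Qed.

Definition perfectSet := {A : {fset Omega} | perfect A}.

Definition Tra : category :=
  @pbij_category perfectSet (fun A => proj1_sig A)
    (fun A B => @tra_morphism (proj1_sig A) (proj1_sig B))
    (fun A => tra_morphism_id (proj1_sig A))
    (fun A B C nu mu => tra_morphism_comp (proj2_sig B)).

End Tra.

Section CubicSpaces.
Variable F : fieldType.

Definition cubic_form (V : lmodType F) (w : V -> V -> V -> F) : Prop :=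
  [/\ forall y z, scalar (fun x => w x y z),
      forall x z, scalar (fun y => w x y z),
      forall x y, scalar (fun z => w x y z),
      forall x y z, w x y z = w y x z &
      forall x y z, w x y z = w x z y].

Record cubicSpace := CubicSpace {
  cubic_sort :> lmodType F;
  cform : cubic_sort -> cubic_sort -> cubic_sort -> F;
  cformP : cubic_form cform }.

Record fdCubicSpace := FdCubicSpace {
  fd_sort : vectType F;
  fd_form : fd_sort -> fd_sort -> fd_sort -> F;
  fd_formP : cubic_form fd_form }.

Coercion cubic_of_fd (V : fdCubicSpace) : cubicSpace := CubicSpace (@fd_formP V).

Section Subspace.
Variables (V : fdCubicSpace) (A : {vspace fd_sort V}).

Definition restr_form (x y z : subvs_of A) : F :=
  fd_form (vsval x) (vsval y) (vsval z).

Lemma restr_formP : cubic_form restr_form.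
Proof.
have [l1 l2 l3 s1 s2] := fd_formP V.
by split=> [y z a u v|x z a u v|x y a u v|x y z|x y z];
  rewrite /restr_form ?linearP /= ?(l1, l2, l3) // (s1, s2).
Qed.

Definition subcubic : fdCubicSpace := FdCubicSpace restr_formP.

End Subspace.

Definition isocubic_embedding (V W : cubicSpace) (f : V -> W) : Prop :=
  [/\ linear f, injective f &
      forall x y z, cform (f x) (f y) (f z) = cform x y z].

Definition isocubic_bijection (V W : cubicSpace) (f : V -> W) : Prop :=
  [/\ linear f, bijective f &
      forall x y z, cform (f x) (f y) (f z) = cform x y z].

Definition countably_infinite_dim (V : lmodType F) : Prop :=
  exists e : nat -> V,
    (forall n (c : 'I_n -> F), \sum_(i < n) c i *: e i = 0 -> forall i, c i = 0) /\
    (forall v, exists n (c : 'I_n -> F), v = \sum_(i < n) c i *: e i).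

Definition urysohn_extension (Z : cubicSpace) : Prop :=
  forall (W : fdCubicSpace) (V : {vspace fd_sort W}),
    (\dim V).+1 = \dim {:fd_sort W} ->
    forall f : subcubic V -> Z, isocubic_embedding f ->
    exists2 h : W -> Z, isocubic_embedding h &
      forall v : subvs_of V, h (vsval v) = f v.

Definition universal_cubic_space (Z : cubicSpace) : Prop :=
  countably_infinite_dim Z /\ urysohn_extension Z.

Section Isoc.
Variable V : cubicSpace.

Definition isoc_set : set (V -> V) := [set f | isocubic_bijection f].

Lemma isoc_bij g : isoc_set g -> bijective g.
Proof. by case. Qed.

Lemma isoc_id : isoc_set id.
Proof. by split=> //; exists id. Qed.

Lemma isoc_comp g h : isoc_set g -> isoc_set h -> isoc_set (g \o h).
Proof.
move=> [lg bg fg] [lh bh fh]; split.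
- by move=> a u v /=; rewrite lh lg.
- exact: bij_comp.
- by move=> x y z /=; rewrite fg fh.
Qed.

Lemma isoc_inv g h : isoc_set g -> cancel g h -> cancel h g -> isoc_set h.
Proof.
move=> [lg bg fg] gK hK; split.
- by move=> a u v; apply: (can_inj gK); rewrite lg !hK.
- by exists g.
- by move=> x y z; rewrite -fg !hK.
Qed.

Definition Isoc : permGroup V := PermGroup isoc_bij isoc_id isoc_comp isoc_inv.

End Isoc.

(* The equivalence says that the graph of [mu] is that of [f : A -> B], so that
   A and B are the domain and the image of [mu]. *)
Definition isocubic_partial (V W : fdCubicSpace)
    (mu : pbij (fd_sort V) (fd_sort W)) : Prop :=
  exists (A : {vspace fd_sort V}) (B : {vspace fd_sort W})
         (f : subcubic A -> subcubic B),
    isocubic_bijection f /\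
    forall x y, mu x = Some y <->
      exists2 a : subvs_of A, vsval a = x & vsval (f a : subvs_of B) = y.

Lemma vspace_of_submod (V : vectType F) (S : set V) :
  S 0 -> (forall a u v, S u -> S v -> S (a *: u + v)) ->
  exists A : {vspace V}, forall v, v \in A <-> S v.
Proof.
move=> S0 SL.
pose P n := `[< exists2 A : {vspace V}, \dim A = n & forall v, v \in A -> S v >].
have exP : exists n, P n.
  exists 0%N; apply/asboolP; exists 0%VS; first exact: dimv0.
  by move=> v; rewrite memv0 => /eqP ->.
have ubP n : P n -> (n <= \dim {:V})%N.
  by move=> /asboolP[A <- _]; apply: dimvS; exact: subvf.
case: (ex_maxnP exP ubP) => n /asboolP[A dA AS] maxn; exists A => v; split=> [/AS //|Sv].
have : P (\dim (<[v]> + A)).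
  apply/asboolP; exists (<[v]> + A)%VS => // u /memv_addP[_ /vlineP[k ->] [w wA ->]].
  by apply: SL => //; exact: AS.
move/maxn; rewrite -dA => le.
have /eqP -> : A == (<[v]> + A)%VS by rewrite eqEdim addvSr.
by apply: (subvP (addvSl _ _)); exact: memv_line.
Qed.

Lemma isocubic_partialP (V W : fdCubicSpace) (mu : pbij (fd_sort V) (fd_sort W)) :
  isocubic_partial mu <->
  [/\ mu 0 = Some 0,
      forall a x x' y y', mu x = Some y -> mu x' = Some y' ->
        mu (a *: x + x') = Some (a *: y + y') &
      forall x1 x2 x3 y1 y2 y3, mu x1 = Some y1 -> mu x2 = Some y2 -> mu x3 = Some y3 ->
        fd_form y1 y2 y3 = fd_form x1 x2 x3].
Proof.
split=> [[A [B [f [[lf bf ff] muE]]]]|[mu0 muL muF]].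
  have f0 : f 0 = 0.
    by have := lf (-1) 0 0; rewrite !scaleN1r !oppr0 !addr0 addNr.
  split.
  - by apply/muE; exists 0 => //; rewrite f0.
  - move=> a x x' y y' /muE[u <- <-] /muE[v <- <-].
    apply/muE; exists (a *: u + v); first by rewrite linearP.
    by rewrite lf linearP.
  - move=> x1 x2 x3 y1 y2 y3 /muE[u <- <-] /muE[v <- <-] /muE[w <- <-].
    exact: ff.
have [A AP] := @vspace_of_submod (fd_sort V) [set x | exists y, mu x = Some y]
  (ex_intro _ _ mu0) (fun a u v '(ex_intro _ H) '(ex_intro _ H') =>
    ex_intro _ _ (muL a _ _ _ _ H H')).
have [B BP] := @vspace_of_submod (fd_sort W) [set y | exists x, mu x = Some y]
  (ex_intro _ _ mu0) (fun a u v '(ex_intro _ H) '(ex_intro _ H') =>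
    ex_intro _ _ (muL a _ _ _ _ H H')).
pose f (a : subvs_of A) : subvs_of B := vsproj B (odflt 0 (mu (vsval a))).
have fE a : mu (vsval a) = Some (vsval (f a)).
  have /AP[y E] := subvsP a; rewrite /f E /= vsprojK //.
  by apply/BP; exists (vsval a).
exists A, B, f; split; last first.
  move=> x y; split=> [E|[a <- <-]]; last exact: fE.
  have xA : x \in A by apply/AP; exists y.
  exists (vsproj A x); first by rewrite vsprojK.
  by have := fE (vsproj A x); rewrite vsprojK // E => -[].
split.
- move=> a u v; apply: subvs_inj.
  have := fE (a *: u + v); rewrite !linearP /= (muL _ _ _ _ _ (fE u) (fE v)).
  by move=> [<-].
- have [g gE] : exists g : subvs_of B -> subvs_of A, forall b, f (g b) = b.
    suff /choice[g gE] : forall b, exists a, f a = b by exists g.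
    move=> b.
    have /BP[x E] := subvsP b.
    have xA : x \in A by apply/AP; exists (vsval b).
    exists (vsproj A x); apply: subvs_inj.
    by have := fE (vsproj A x); rewrite vsprojK // E => -[].
  exists g => // a; apply: subvs_inj.
  by apply: (pfun_inj (fE _)); rewrite gE; exact: fE.
- by move=> x y z; apply: muF; exact: fE.
Qed.

Lemma isocubic_partial_id (V : fdCubicSpace) : isocubic_partial (pbij_id (fd_sort V)).
Proof.
apply/isocubic_partialP; split=> //.
- by move=> a x x' y y' [->] [->].
- by move=> x1 x2 x3 y1 y2 y3 [->] [->] [->].
Qed.

Lemma isocubic_partial_comp (U V W : fdCubicSpace)
    (nu : pbij (fd_sort V) (fd_sort W)) (mu : pbij (fd_sort U) (fd_sort V)) :
  isocubic_partial nu -> isocubic_partial mu -> isocubic_partial (pbij_comp nu mu).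
Proof.
move=> /isocubic_partialP[n0 nL nF] /isocubic_partialP[m0 mL mF].
have compE x z : pbij_comp nu mu x = Some z ->
    exists2 y, mu x = Some y & nu y = Some z.
  by rewrite /=; case: (mu x) => [y|] //= E; exists y.
apply/isocubic_partialP; split.
- by rewrite /= m0 /= n0.
- move=> a x x' z z' /compE[y E1 E2] /compE[y' E1' E2'].
  by rewrite /= (mL _ _ _ _ _ E1 E1') /= (nL _ _ _ _ _ E2 E2').
- move=> x1 x2 x3 z1 z2 z3 /compE[y1 E1 E1'] /compE[y2 E2 E2'] /compE[y3 E3 E3'].
  by rewrite (nF _ _ _ _ _ _ E1' E2' E3') (mF _ _ _ _ _ _ E1 E2 E3).
Qed.

Definition fdCubicCategory : category :=
  @pbij_category fdCubicSpace fd_sort isocubic_partial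
    isocubic_partial_id isocubic_partial_comp.

End CubicSpaces.

(* Main.v *)
(** The space Z is homogeneous: by back-and-forth along a basis, the Urysohn
    property extends every isocubic bijection between finite-dimensional subspaces
    to an element of Isoc(Z). Hence the perfect sets are exactly the finite linear
    subspaces: a perfect set contains all points fixed by its stabilizer, and a
    vector x outside of a finite subspace A has an infinite orbit because it can be
    copied over A outside of any given finite-dimensional subspace. Choosing for
    each perfect set a vector space that parametrises it gives a functor, which is
    fully faithful by homogeneity and Neumann's lemma, and essentially surjective
    since the Urysohn property embeds every finite-dimensional cubic space in Z. *)

From mathcomp Require Import all_boot all_order all_algebra.
From mathcomp Require Import finmap boolp classical_sets cardinality.
Require Import Defs.
Set Implicit Arguments.
Unset Strict Implicit.
Unset Printing Implicit Defensive.
Import GRing.Theory VectorInternalTheory.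
Local Open Scope ring_scope.

(** * Equivalences from fully faithful, essentially surjective functors *)

(** The inverse functor is built by choice: a morphism goes to the lift of its conjugate by the
    chosen isomorphisms [e d]. Identities in [C] are checked after applying [F], by faithfulness. *)
Lemma equivalence_of_fully_faithful_ess_surj (C D : category) (F : functor C D) :
  (forall a b (f g : hom a b), fmap F f = fmap F g -> f = g) ->
  (forall a b (h : hom (F a) (F b)), exists f, fmap F f = h) ->
  (forall d, exists a, exists f : hom (F a) d, is_iso f) ->
  equivalent_categories C D.
Proof.
move=> faith full esurj.
pose G0 d := projT1 (cid (esurj d)).
pose e d : hom (F (G0 d)) d := projT1 (cid (projT2 (cid (esurj d)))).
have e_iso d : is_iso (e d) := projT2 (cid (projT2 (cid (esurj d)))).
pose e' d := projT1 (cid (e_iso d)).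
have e'K d : comp (e' d) (e d) = idm _ by case: (projT2 (cid (e_iso d))).
have eK d : comp (e d) (e' d) = idm _ by case: (projT2 (cid (e_iso d))).
pose lift a b h := projT1 (cid (full a b h)).
have liftE a b h : fmap F (lift a b h) = h := projT2 (cid (full a b h)).
pose G1 d d' (g : hom d d') := lift _ _ (comp (e' d') (comp g (e d))).
have G_id d : G1 _ _ (idm d) = idm (G0 d).
  by apply: faith; rewrite liftE fmap_id comp_idl e'K.
have G_comp a b c (g : hom b c) (f : hom a b) :
    G1 _ _ (comp g f) = comp (G1 _ _ g) (G1 _ _ f).
  apply: faith; rewrite fmap_comp !liftE -!comp_assoc; congr comp; congr comp.
  by rewrite comp_assoc eK comp_idl.
pose G := Functor G_id G_comp.
exists F, G; split.
  exists (fun a => lift (G0 (F a)) a (e (F a))); split=> [a|a b f] /=.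
    exists (lift _ _ (e' (F a))).
    by split; apply: faith; rewrite fmap_comp !liftE fmap_id ?e'K ?eK.
  apply: faith; rewrite !fmap_comp /= !liftE !comp_assoc.
  by rewrite eK comp_idl.
exists e; split=> [d|d d' g] /=; first exact: e_iso.
by rewrite liftE !comp_assoc eK comp_idl.
Qed.

(** * Bare functions satisfying [linear], and operations on cubic forms *)

Section RawLinear.
Variables (F : fieldType) (U V : lmodType F) (f : U -> V).
Hypothesis lf : linear f.

Lemma raw_linear0 : f 0 = 0.
Proof. by have := lf (-1) 0 0; rewrite !scaleN1r !oppr0 !addr0 addNr. Qed.

Lemma raw_linearZ a u : f (a *: u) = a *: f u.
Proof. by rewrite -[a *: u]addr0 lf raw_linear0 addr0. Qed.

Lemma raw_linearD u v : f (u + v) = f u + f v.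
Proof. by rewrite -[u]scale1r lf !scale1r. Qed.

Lemma raw_linear_inj : (forall u, f u = 0 -> u = 0) -> injective f.
Proof.
move=> f0 u v e; apply/eqP; rewrite -subr_eq0; apply/eqP/f0.
by rewrite raw_linearD -scaleN1r raw_linearZ scaleN1r e subrr.
Qed.

End RawLinear.

Section CubicForms.
Variable F : fieldType.

Lemma cubic_form_pullback (U V : lmodType F) (w : V -> V -> V -> F) (f : U -> V) :
  linear f -> cubic_form w -> cubic_form (fun x y z => w (f x) (f y) (f z)).
Proof.
move=> lf [l1 l2 l3 s1 s2].
by split=> [y z a u v|x z a u v|x y a u v|x y z|x y z];
  rewrite ?lf ?(l1, l2, l3) // (s1, s2).
Qed.

Lemma cubic_formD (V : lmodType F) (w w' : V -> V -> V -> F) :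
  cubic_form w -> cubic_form w' -> cubic_form (fun x y z => w x y z + w' x y z).
Proof.
move=> [l1 l2 l3 s1 s2] [l1' l2' l3' s1' s2'].
split=> [y z a u v|x z a u v|x y a u v|x y z|x y z] /=.
- by rewrite (l1 y z a u v) (l1' y z a u v) addrACA mulrDr.
- by rewrite (l2 x z a u v) (l2' x z a u v) addrACA mulrDr.
- by rewrite (l3 x y a u v) (l3' x y a u v) addrACA mulrDr.
- by rewrite s1 s1'.
- by rewrite s2 s2'.
Qed.

Lemma cubic_formN (V : lmodType F) (w : V -> V -> V -> F) :
  cubic_form w -> cubic_form (fun x y z => - w x y z).
Proof.
move=> [l1 l2 l3 s1 s2].
split=> [y z a u v|x z a u v|x y a u v|x y z|x y z] /=.
- by rewrite (l1 y z a u v) opprD mulrN.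
- by rewrite (l2 x z a u v) opprD mulrN.
- by rewrite (l3 x y a u v) opprD mulrN.
- by rewrite s1.
- by rewrite s2.
Qed.

End CubicForms.

(** * Homogeneity of the universal cubic space *)

Section Universal.
Variables (F : fieldType) (Z : cubicSpace F).
Hypothesis hU : urysohn_extension Z.

(** Pairs replace abstract hyperplanes: [W] is the kernel of the second projection, of codimension 1
    by rank-nullity. Beyond its values on [W], the form [w] can be chosen freely. *)
Lemma urysohn_prod (W : vectType F) (w : W * F^o -> W * F^o -> W * F^o -> F)
    (g : W -> Z) :
  cubic_form w -> linear g -> injective g ->
  (forall x y z, cform (g x) (g y) (g z) = w (x, 0) (y, 0) (z, 0)) ->
  exists h : W * F^o -> Z,
    [/\ linear h, injective h,
        forall x y z, cform (h x) (h y) (h z) = w x y z &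
        forall x, h (x, 0) = g x].
Proof.
move=> cw lg ig gw.
pose p : 'Hom((W * F^o)%type, F^o) := linfun snd.
have pE x : p x = x.2 by rewrite lfunE.
pose V := lker p.
have VP (x : W * F^o) : (x \in V) = (x.2 == 0) by rewrite memv_ker pE.
have dV : (\dim V).+1 = \dim {: (W * F^o)%type}.
  rewrite -(limg_ker_dim p fullv) capfv -addn1; congr (_ + _)%N.
  have -> : limg p = fullv.
    apply/vspaceP => x; rewrite memvf; apply/memv_imgP.
    by exists (0, x); rewrite ?memvf ?pE.
  by rewrite dimvf.
pose W' := FdCubicSpace cw.
pose f (v : subvs_of V) := g (vsval v).1.
have ff : @isocubic_embedding _ (@subcubic _ W' V) Z f.
  split.
  - by move=> a u v; rewrite /f linearP lg.
  - move=> u v /ig e; apply: subvs_inj.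
    have := subvsP u; have := subvsP v; rewrite !VP.
    move: (vsval u) (vsval v) e => [u1 u2] [v1 v2] /= ->.
    by move=> /eqP-> /eqP->.
  - move=> x y z; rewrite /f gw /= /restr_form /=.
    have E (u : subvs_of V) : ((vsval u).1, 0) = vsval u.
      by have := subvsP u; rewrite VP; case: (vsval u) => [u1 u2] /= /eqP ->.
    by rewrite !E.
have [h [lh ih hh] hf] := @hU W' V dV f ff.
exists h; split=> // x.
have xV : (x, 0) \in V by rewrite VP.
by have := hf (Subvs xV); rewrite /f /= => ->.
Qed.

End Universal.

Section PartialIsometries.
Variables (F : fieldType) (Z : cubicSpace F).

(* The graph of an isocubic bijection between two finite-dimensional subspaces
   of Z, both parametrised by the same space W. *)
Definition fd_partial_iso (P : Z -> Z -> Prop) : Prop :=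
  exists (W : vectType F) (f g : W -> Z),
    [/\ linear f /\ injective f, linear g /\ injective g,
        forall x y z, cform (f x) (f y) (f z) = cform (g x) (g y) (g z) &
        forall u v, P u v <-> exists2 w, f w = u & g w = v].

Lemma fd_partial_iso_sym P :
  fd_partial_iso P -> fd_partial_iso (fun u v => P v u).
Proof.
move=> [W [f [g [lf lg fg PE]]]]; exists W, g, f; split=> // u v.
by rewrite PE; split=> -[w]; exists w.
Qed.

(** These facts pass to the union of a chain of such relations; injectivity comes from the symmetric
    relation. *)
Lemma fd_partial_isoP P : fd_partial_iso P ->
  [/\ forall u v v', P u v -> P u v' -> v = v',
      forall a u v u' v', P u v -> P u' v' -> P (a *: u + u') (a *: v + v'),
      P 0 0 &
      forall x y z x' y' z', P x x' -> P y y' -> P z z' ->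
        cform x' y' z' = cform x y z].
Proof.
move=> [W [f [g [[lf jf] [lg jg] fg PE]]]]; split.
- by move=> u v v' /PE[w <- <-] /PE[w' /jf -> <-].
- move=> a u v u' v' /PE[w <- <-] /PE[w' <- <-].
  by apply/PE; exists (a *: w + w'); rewrite (lf, lg).
- by apply/PE; exists 0; exact: raw_linear0.
- by move=> x y z x' y' z' /PE[u <- <-] /PE[v <- <-] /PE[w <- <-].
Qed.

Lemma fd_partial_iso_span P (e : nat -> Z) n (c : 'I_n -> F) :
  fd_partial_iso P -> (forall i, (i < n)%N -> exists y, P (e i) y) ->
  exists y, P (\sum_(i < n) c i *: e i) y.
Proof.
move=> /fd_partial_isoP[_ PL P0 _] Pe; elim/big_ind: _ => [|u v [u' Pu] [v' Pv]|i _].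
- by exists 0.
- by exists (1 *: u' + v'); rewrite -[u]scale1r; exact: PL.
- have [y Py] := Pe i (ltn_ord i).
  by exists (c i *: y + 0); rewrite -[X in P X]addr0; exact: PL.
Qed.

Hypothesis hU : urysohn_extension Z.

(** The span of the domain and [x] is parametrised by pairs through [f'], and its form is pulled
    back to them. Then [g] embeds the hyperplane [W], and its extension [h] gives [x] the image
    [h (0, 1)]. *)
Lemma fd_partial_iso_forth P x : fd_partial_iso P ->
  exists2 P', fd_partial_iso P' &
    (forall u v, P u v -> P' u v) /\ exists y, P' x y.
Proof.
move=> Piso; have [Px|nPx] := pselect (exists y, P x y); first by exists P.
move: Piso => [W [f [g [[lf jf] [lg jg] fg PE]]]].
pose f' (p : W * F^o) := f p.1 + (p.2 : F) *: x.
have lf' : linear f'.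
  move=> a u v; rewrite /f' /= lf scalerDl -!scalerA scalerDr addrACA.
  by rewrite /GRing.scale /= ?scalerA.
have jf' : injective f'.
  apply: raw_linear_inj => // -[w t]; rewrite /f' /= => e.
  (* Otherwise [x] would be the image under [f] of [- t^-1 *: w], hence in the domain of [P]. *)
  have t0 : t = 0.
    apply: contrapT => /eqP t0; apply: nPx; exists (g (- t^-1 *: w)).
    apply/PE; exists (- t^-1 *: w) => //.
    rewrite raw_linearZ // scaleNr.
    have /eqP := e; rewrite addr_eq0 => /eqP ->.
    by rewrite scalerN opprK scalerA mulVf // scale1r.
  move: e; rewrite t0 scale0r addr0 => fw; congr pair.
  by apply: jf; rewrite fw raw_linear0.
have [|h [lh jh hh hg]] := @urysohn_prod F Z hU W _ g
   (cubic_form_pullback lf' (cformP Z)) lg jg.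
  by move=> u v w; rewrite /f' /= !scale0r !addr0 fg.
exists (fun u v => exists2 w, f' w = u & h w = v).
  by exists (W * F^o)%type, f', h; split.
split; last first.
  by exists (h (0, 1)), (0, 1); rewrite // /f' /= raw_linear0 // add0r scale1r.
by move=> u v /PE[w <- <-]; exists (w, 0); rewrite // /f' /= scale0r addr0.
Qed.

Lemma fd_partial_iso_back_forth P x : fd_partial_iso P ->
  exists2 P', fd_partial_iso P' &
    [/\ forall u v, P u v -> P' u v, exists y, P' x y & exists y, P' y x].
Proof.
move=> /(fd_partial_iso_forth x)[P1 iso1 [P01 [y P1y]]].
have [P2 iso2 [P12 [z P2z]]] := fd_partial_iso_forth x (fd_partial_iso_sym iso1).
exists (fun u v => P2 v u); first exact: fd_partial_iso_sym.
split; [|exists y|exists z] => //; last exact: P12.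
by move=> u v /P01/P12.
Qed.

Hypothesis hD : countably_infinite_dim Z.

(** The graph of [k] is the union of a chain of partial isometries; each axiom concerns finitely
    many vectors, which lie in a common stage. *)
Lemma fd_partial_iso_extend P : fd_partial_iso P ->
  exists2 k : Z -> Z, isocubic_bijection k & forall u v, P u v -> k u = v.
Proof.
move=> Piso; have [e [_ espan]] := hD.
pose T := {P : Z -> Z -> Prop | fd_partial_iso P}.
have /choice[next nextP] : forall p : nat * T, exists q : T,
    [/\ forall u v, sval p.2 u v -> sval q u v,
        exists y, sval q (e p.1) y & exists y, sval q y (e p.1)].
  move=> [n [Q isoQ]] /=.
  by have [Q' isoQ' H] := fd_partial_iso_back_forth (e n) isoQ; exists (exist _ Q' isoQ').
(* Stage [n.+1] has [e n] in both its domain and its image, so the union is total and onto by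
   linearity. *)
pose fix Q n : T := if n is m.+1 then next (m, Q m) else exist _ P Piso.
have Qmono m n u v : (m <= n)%N -> sval (Q m) u v -> sval (Q n) u v.
  move=> /subnK <-; elim: (n - m)%N => [//|d IH] /IH.
  by rewrite addSn /=; have [H _ _] := nextP ((d + m)%N, Q (d + m)%N); exact: H.
pose R u v := exists n, sval (Q n) u v.
have common u v u' v' : R u v -> R u' v' ->
    exists n, sval (Q n) u v /\ sval (Q n) u' v'.
  move=> [m Qm] [n Qn]; exists (maxn m n).
  by split; [apply: Qmono Qm; exact: leq_maxl|apply: Qmono Qn; exact: leq_maxr].
have Qiso n : fd_partial_iso (sval (Q n)) := svalP (Q n).
have Rtotal u : exists v, R u v.
  have [n [c ->]] := espan u.
  have [i lt_in|y Py] := fd_partial_iso_span c (Qiso n) (e := e).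
    have [_ [y Qy] _] := nextP (i, Q i); exists y.
    by apply: (@Qmono i.+1).
  by exists y, n.
have Rsurj v : exists u, R u v.
  have [n [c ->]] := espan v.
  have [i lt_in|y Py] := fd_partial_iso_span c (fd_partial_iso_sym (Qiso n)) (e := e).
    have [_ _ [y Qy]] := nextP (i, Q i); exists y.
    by apply: (@Qmono i.+1).
  by exists y, n.
have Rfun u v v' : R u v -> R u v' -> v = v'.
  move=> Ruv Ruv'; have [n []] := common _ _ _ _ Ruv Ruv'.
  by have [H _ _ _] := fd_partial_isoP (Qiso n); exact: H.
have Rinj u u' v : R u v -> R u' v -> u = u'.
  move=> Ruv Ruv'; have [n []] := common _ _ _ _ Ruv Ruv'.
  by have [H _ _ _] := fd_partial_isoP (fd_partial_iso_sym (Qiso n)); exact: H.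
have [k Rk] := choice Rtotal; have [k' Rk'] := choice Rsurj.
exists k; last by move=> u v Puv; apply: Rfun (Rk u) _; exists 0%N.
split.
- move=> a u v; apply: Rfun (Rk _) _.
  have [n [Qu Qv]] := common _ _ _ _ (Rk u) (Rk v); exists n.
  by have [_ H _ _] := fd_partial_isoP (Qiso n); exact: H.
- exists k' => u; first exact: Rinj (Rk' _) (Rk _).
  exact: Rfun (Rk _) (Rk' _).
- move=> x y z; have [n [Qx Qy]] := common _ _ _ _ (Rk x) (Rk y).
  have [m Qz] := Rk z.
  have [_ _ _ H] := fd_partial_isoP (Qiso (maxn m n)).
  apply: H; first [exact: Qmono (leq_maxr _ _) Qx
    | exact: Qmono (leq_maxr _ _) Qy | exact: Qmono (leq_maxl _ _) Qz].
Qed.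

End PartialIsometries.

(** * Perfect sets as finite linear subspaces *)

Section PerfectSets.
Variables (F : fieldType) (Z : cubicSpace F).

Definition fset_submod (A : {fset Z}) : Prop :=
  0 \in A /\ forall a u v, u \in A -> v \in A -> a *: u + v \in A.

(** Elements of [Isoc Z] are linear, so the stabilizer of [A] fixes 0 and every linear combination
    of points of [A]. *)
Lemma perfect_submod (A : {fset Z}) : perfect (Isoc Z) A -> fset_submod A.
Proof.
move=> pA.
have fixA x : (forall g, pstab (Isoc Z) A g -> g x = x) -> x \in A.
  move=> gx; apply: contrapT => /negP /pA; apply.
  apply: (@sub_finite_set _ _ [set x]); last exact: finite_set1.
  by move=> _ [g gA <-] /=; exact: gx.
split=> [|a u v uA vA]; apply: fixA => g [[lg _ _] gA]; first exact: raw_linear0.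
by rewrite lg !gA.
Qed.

Hypothesis hD : countably_infinite_dim Z.

(** Finitely many vectors involve finitely many basis vectors. Row vectors serve as coordinates on
    their span, since [Z] is not a [vectType]. *)
Lemma seq_in_fd_subspace (s : seq Z) :
  exists N (phi : 'rV[F]_N -> Z),
    [/\ linear phi, injective phi & forall x, x \in s -> exists c, phi c = x].
Proof.
have [e [efree espan]] := hD.
pose phi N (c : 'rV[F]_N) := \sum_(i < N) c 0 i *: e i.
have lphi N : linear (@phi N).
  move=> a u v; rewrite /phi scaler_sumr -big_split /=.
  by apply: eq_bigr => i _; rewrite !mxE scalerDl scalerA.
have widen N M c : (N <= M)%N -> exists c', @phi M c' = @phi N c.
  (* Coordinates beyond [N] default to 0. *)
  move=> leNM; pose d i : F := oapp (c 0) 0 (insub i : option 'I_N).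
  have -> : @phi N c = \sum_(i < N) d i *: e i.
    by apply: eq_bigr => i _; rewrite /d valK.
  exists (\row_i d i); rewrite (big_ord_widen M (fun i => d i *: e i)) //.
  rewrite big_mkcond; apply: eq_bigr => i _; rewrite mxE /d.
  by case: ltnP => // leNi; rewrite insubN ?scale0r // -leqNgt.
have [N sN] : exists N, forall x, x \in s -> exists c, @phi N c = x.
  elim: s => [|x s [N IH]]; first by exists 0%N.
  have [n [c xE]] := espan x; exists (maxn n N) => y.
  rewrite inE => /orP[/eqP->|/IH[c' <-]]; last exact: widen (leq_maxr _ _).
  have [c' c'E] := widen n (maxn n N) (\row_i c i) (leq_maxl _ _).
  by exists c'; rewrite c'E xE; apply: eq_bigr => i _; rewrite mxE.
exists N, (@phi N); split=> //; apply: (raw_linear_inj (lphi N)) => u u0.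
by apply/rowP => i; rewrite mxE; exact: (efree N (u 0)).
Qed.

Lemma fset_submod_param (A : {fset Z}) : fset_submod A ->
  exists (V : fdCubicSpace F) (f : V -> Z),
    isocubic_embedding f /\ forall z, z \in A <-> exists v, f v = z.
Proof.
move=> [A0 AL]; have [N [phi [lphi jphi phiA]]] := seq_in_fd_subspace A.
have [||U UP] := @vspace_of_submod F 'rV[F]_N [set c | phi c \in A].
- by rewrite /= raw_linear0.
- by move=> a u v uA vA; rewrite /= lphi; exact: AL.
pose f (u : subvs_of U) := phi (vsval u).
have lf : linear f by move=> a u v; rewrite /f linearP lphi.
exists (FdCubicSpace (cubic_form_pullback lf (cformP Z))), f; split.
  by split=> // u v /jphi; exact: subvs_inj.
move=> z; split=> [zA|[v <-]]; last exact/UP/subvsP.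
have [c cz] := phiA z zA.
have cU : c \in U by apply/UP; rewrite /= cz.
by exists (Subvs cU).
Qed.

Hypothesis hU : urysohn_extension Z.

(* If the orbit of x lay in a finite-dimensional B containing A, one could adjoin
   to B a vector y outside of B having the same products as x over A: glue the
   forms of B and of A + <x> along A, by means of a projection of B onto A. By
   homogeneity y is in the orbit of x. *)
Lemma submod_perfect (A : {fset Z}) : fset_submod A -> perfect (Isoc Z) A.
Proof.
move=> [A0 AL] x xA /finite_seqP[s sE].
(* [phi] parametrises a space B that contains both the orbit of [x] and [A]; below, [U] is [A] in
   these coordinates. *)
have [N [phi [lphi jphi phiP]]] := seq_in_fd_subspace (s ++ A).
have [||U UP] := @vspace_of_submod F 'rV[F]_N [set c | phi c \in A].
- by rewrite /= raw_linear0.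
- by move=> a u v uA vA; rewrite /= lphi; exact: AL.
have orbE g : pstab (Isoc Z) A g -> exists c, phi c = g x.
  move=> gA; apply: phiP; rewrite mem_cat; apply/orP; left.
  have : [set g x | g in pstab (Isoc Z) A]%classic (g x) by exists g.
  by rewrite sE.
have [x0 x0E] : exists c, phi c = x.
  by apply: (orbE id); split=> //; exact: isoc_id.
have x0U : x0 \notin U by apply/negP => /UP; rewrite /= x0E; exact/negP.
pose W := ('rV[F]_N * F^o)%type.
pose p (b : W) := phi (projv U b.1 + (b.2 : F) *: x0).
have lp : linear p.
  move=> a u v; rewrite /p -lphi; congr phi; rewrite /= linearP scalerDl scalerDr.
  by rewrite addrACA scalerA.
have lq : linear (fun b : W => phi b.1) by move=> a u v; rewrite -lphi.
have lr : linear (fun b : W => phi (projv U b.1)).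
  by move=> a u v; rewrite -lphi /= linearP.
(* Inclusion-exclusion. On B the second coordinate is 0 and the last two terms cancel; over [A] the
   projection is the identity, so the first and third cancel and the form of A + <x> remains. *)
pose w (b1 b2 b3 : W) := cform (phi b1.1) (phi b2.1) (phi b3.1) +
  (cform (p b1) (p b2) (p b3) -
   cform (phi (projv U b1.1)) (phi (projv U b2.1)) (phi (projv U b3.1))).
have cw : cubic_form w.
  apply: cubic_formD; first exact: cubic_form_pullback lq (cformP Z).
  apply: cubic_formD; first exact: cubic_form_pullback lp (cformP Z).
  exact/cubic_formN/(cubic_form_pullback lr (cformP Z)).
have [|h [lh jh hw hphi]] := urysohn_prod hU cw lphi jphi.
  by move=> b1 b2 b3; rewrite /w /p /= !scale0r !addr0 subrr addr0.
pose T := (subvs_of U * F^o)%type.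
(* [f1] parametrises A + <x>, and [f2] its copy A + <y> with [y = h (0, 1)]. *)
pose f1 (t : T) := phi (vsval t.1 + (t.2 : F) *: x0).
pose f2 (t : T) := h (vsval t.1, t.2).
have lf1 : linear f1.
  move=> a u v; rewrite /f1 -lphi; congr phi.
  have -> : vsval (a *: u + v).1 = a *: vsval u.1 + vsval v.1 by exact: linearP.
  rewrite scalerDl scalerDr.
  by rewrite addrACA scalerA.
have lf2 : linear f2 by move=> a u v; rewrite /f2 -lh; congr h; congr pair; exact: linearP.
have jf1 : injective f1.
  apply: raw_linear_inj => // -[u t]; rewrite /f1 /= => e.
  have {}e : vsval u + (t : F) *: x0 = 0 by apply: jphi; rewrite e raw_linear0.
  have t0 : t = 0.
    apply: contrapT => /eqP t0; move/negP: x0U; apply.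
    have /eqP := e; rewrite addrC addr_eq0 => /eqP tx.
    have -> : x0 = - (t^-1 : F) *: vsval u.
      by rewrite scaleNr -scalerN -tx scalerA mulVf // scale1r.
    exact/memvZ/subvsP.
  by move: e; rewrite t0 scale0r addr0 => u0; congr pair; apply: subvs_inj;
    rewrite u0 linear0.
have jf2 : injective f2.
  by move=> [u t] [u' t'] /jh /= [/subvs_inj -> ->].
have f12 t1 t2 t3 : cform (f1 t1) (f1 t2) (f1 t3) = cform (f2 t1) (f2 t2) (f2 t3).
  rewrite /f2 hw /w /p /= !(projv_id (subvsP _)).
  by rewrite addrC subrK.
have [|k isok kE] := fd_partial_iso_extend hU hD
    (P := fun u v => exists2 t, f1 t = u & f2 t = v).
  by exists T, f1, f2; split.
have [|c ck] := orbE k.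
  split=> // a aA; have [c cE] : exists c, phi c = a.
    by apply: phiP; rewrite mem_cat aA orbT.
  have cU : c \in U by apply/UP; rewrite /= cE.
  apply: kE; exists (Subvs cU, 0); first by rewrite /f1 /= scale0r addr0.
  by rewrite /f2 /= hphi.
(* This point is in the orbit of [x], hence in B, whose points are the [h (c, 0)]; injectivity of
   [h] forces 0 = 1. *)
have : k x = f2 (0, 1).
  by apply: kE; exists (0, 1) => //; rewrite /f1 /= add0r scale1r.
rewrite -ck -hphi => /jh [_ /eqP].
by rewrite eq_sym oner_eq0.
Qed.

(** Induction on the dimension: a hyperplane embeds, and the Urysohn property adds the last
    dimension. *)
Lemma fd_embedding (V : fdCubicSpace F) : exists h : V -> Z, isocubic_embedding h.
Proof.
move: {2}(\dim {:fd_sort V}) (erefl (\dim {:fd_sort V})) => n.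
elim: n V => [|n IH] V dV.
  have V0 (v : fd_sort V) : v = 0.
    apply/eqP; rewrite -memv0 -[0%VS](_ : fullv = _) ?memvf //.
    by apply/eqP; rewrite -dimv_eq0 dV.
  exists (fun=> 0); split.
  - by move=> a u v; rewrite scaler0 addr0.
  - by move=> u v _; rewrite (V0 u) (V0 v).
  - move=> x y z; rewrite (V0 x).
    have [l _ _ _ _] := cformP Z; have [l' _ _ _ _] := cformP V.
    have := l 0 0 (-1) 0 0; have := l' y z (-1) 0 0.
    by rewrite !scaleN1r !oppr0 !addr0 !mulN1r !addNr => -> ->.
(* The space is nonzero, so [vpick] gives a nonzero vector; a complement of its line is a
   hyperplane. *)
pose H := (<[vpick {:fd_sort V}]>^C)%VS.
have dH : (\dim H).+1 = \dim {:fd_sort V}.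
  rewrite dimv_compl dim_vline vpick0 -dimv_eq0 dimvf /=.
  by move: dV; rewrite dimvf => ->; rewrite subn1.
have [|f femb] := IH (subcubic H).
  by move: dH; rewrite dV => -[] <-; rewrite dimvf.
by have [h hemb _] := hU dH femb; exists h.
Qed.

End PerfectSets.

(** Finiteness of [F] enters here: the coordinate vectors form a finite type. *)
Lemma fd_image_fset (F : finFieldType) (V : vectType F) (T : choiceType) (h : V -> T) :
  exists A : {fset T}, forall z, z \in A <-> exists v, h v = z.
Proof.
exists [fset h (r2v u) | u : 'rV[F]_(dim V)]%fset => z; split.
  by move=> /imfsetP[u _ ->]; exists (r2v u).
by move=> [v <-]; apply/imfsetP; exists (v2r v); rewrite ?v2rK.
Qed.

(** * The functor from perfect sets to cubic spaces *)

Section Transport.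
Variables (X X' Y Y' : Type) (up : X' -> X) (dn : Y -> Y') (mu : pbij X Y).
Hypotheses (up_inj : injective up) (dn_inj : injective dn).

Lemma transport_pbij_inj v v' w :
  omap dn (mu (up v)) = Some w -> omap dn (mu (up v')) = Some w -> v = v'.
Proof.
case E : (mu (up v)) => [y|] //= [<-]; case E' : (mu (up v')) => [y'|] //= [].
by move=> /dn_inj yy; rewrite yy in E'; exact/up_inj/(pfun_inj E E').
Qed.

Definition transport_pbij : pbij X' Y' := PBij transport_pbij_inj.

End Transport.

Section Equivalence.
Variables (F : fieldType) (Z : cubicSpace F).
Hypothesis hZ : universal_cubic_space Z.
Let hD : countably_infinite_dim Z := proj1 hZ.
Let hU : urysohn_extension Z := proj2 hZ.

Implicit Types A B : perfectSet (Isoc Z).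

(** A perfect set is a finite subspace and carries the restricted form; the inverse maps are
    recorded for transporting partial bijections. *)
Lemma perfect_model (A : perfectSet (Isoc Z)) :
  exists (V : fdCubicSpace F) (up : fd_sort V -> sval A) (dn : sval A -> fd_sort V),
    [/\ cancel up dn, cancel dn up &
        @isocubic_embedding F V Z (fun v => val (up v))].
Proof.
case: A => A pA /=.
have [V [f [[lf jf ff] fA]]] := fset_submod_param hD (perfect_submod pA).
have fV v : f v \in A by apply/fA; exists v.
have /choice[dn dnE] : forall a : A, exists v, f v = val a.
  by move=> a; apply/fA; exact: valP.
exists V, (fun v => FSetSub (fV v)), dn; split=> //.
- by move=> v; apply: jf; rewrite dnE.
- by move=> a; apply: val_inj => /=; rewrite dnE.
Qed.

Definition model (A : perfectSet (Isoc Z)) : fdCubicSpace F :=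
  projT1 (cid (perfect_model A)).

Definition model_up A : fd_sort (model A) -> sval A :=
  projT1 (cid (projT2 (cid (perfect_model A)))).

Definition model_dn A : sval A -> fd_sort (model A) :=
  projT1 (cid (projT2 (cid (projT2 (cid (perfect_model A)))))).

Lemma modelP A : [/\ cancel (@model_up A) (@model_dn A),
  cancel (@model_dn A) (@model_up A) &
  @isocubic_embedding F (model A) Z (fun v => val (model_up v))].
Proof. exact: projT2 (cid (projT2 (cid (projT2 (cid (perfect_model A)))))). Qed.

Lemma model_upK A : cancel (@model_up A) (@model_dn A).
Proof. by have [] := modelP A. Qed.

Lemma model_dnK A : cancel (@model_dn A) (@model_up A).
Proof. by have [] := modelP A. Qed.

Definition to_model A B (mu : pbij (sval A) (sval B)) :
    pbij (fd_sort (model A)) (fd_sort (model B)) :=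
  transport_pbij mu (can_inj (@model_upK A)) (can_inj (@model_dnK B)).

Lemma to_modelP A B (mu : pbij (sval A) (sval B)) v w :
  to_model mu v = Some w <-> mu (model_up v) = Some (model_up w).
Proof.
rewrite /=; case: (mu _) => [b|] /=; split=> // -[].
  by move=> <-; rewrite model_dnK.
by move=> ->; rewrite model_upK.
Qed.

(** Seen in [Z], the graph of [to_model mu] is the relation that [g] sends one point to the other
    ([gE]), so all conditions are inherited from [g] and the embeddings. *)
Lemma to_model_isocubic A B (mu : pbij (sval A) (sval B)) :
  @tra_morphism Z (Isoc Z) _ _ mu -> isocubic_partial (to_model mu).
Proof.
move=> [g [lg _ gg] muE].
have [_ _ [lA _ cA]] := modelP A; have [_ _ [lB _ cB]] := modelP B.
have gE v w : to_model mu v = Some w <-> g (val (model_up v)) = val (model_up w).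
  rewrite to_modelP muE; case: insubP => [b _ <-|nB]; split=> //.
  - by move=> [->].
  - by move=> /val_inj ->.
  - by move=> e; rewrite e (valP (model_up w)) in nB.
apply/isocubic_partialP; split.
- by apply/gE; rewrite (raw_linear0 lA) (raw_linear0 lB) (raw_linear0 lg).
- move=> a x x' y y' /gE gx /gE gx'.
  by apply/gE; rewrite lA lg lB gx gx'.
- move=> x1 x2 x3 y1 y2 y3 /gE e1 /gE e2 /gE e3.
  by rewrite -[LHS]cB -[RHS]cA -e1 -e2 -e3 gg.
Qed.

Definition model_fmap (A B : Tra (Isoc Z)) (mu : hom A B) :
    @hom (fdCubicCategory F) (model A) (model B) :=
  exist _ (to_model (sval mu)) (to_model_isocubic (svalP mu)).

Lemma model_fmap_id (A : Tra (Isoc Z)) :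
  model_fmap (idm A) = @idm (fdCubicCategory F) (model A).
Proof. by apply: pbij_hom_eq => v /=; rewrite model_upK. Qed.

Lemma model_fmap_comp (A B C : Tra (Isoc Z)) (g : hom B C) (f : hom A B) :
  model_fmap (comp g f) = comp (model_fmap g) (model_fmap f).
Proof.
apply: pbij_hom_eq => v /=; case: (sval f _) => //= b.
by rewrite model_dnK.
Qed.

Definition model_functor : functor (Tra (Isoc Z)) (fdCubicCategory F) :=
  Functor model_fmap_id model_fmap_comp.

Lemma model_functor_faithful (A B : Tra (Isoc Z)) (f g : hom A B) :
  fmap model_functor f = fmap model_functor g -> f = g.
Proof.
move=> fg; apply: pbij_hom_eq => a.
have := congr1 (fun m : @hom (fdCubicCategory F) (model A) (model B) =>
  pfun (sval m) (model_dn a)) fg.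
by rewrite /= model_dnK; apply: inj_omap; exact: can_inj (@model_dnK B).
Qed.

(* An extension g0 of nu may send points outside of dom nu into B; composing it
   with an element of the stabilizer of im nu given by Neumann's lemma makes the
   domain of g|_{A -> B} exactly dom nu. *)
Lemma model_functor_full (A B : Tra (Isoc Z))
    (nu : hom (model_functor A) (model_functor B)) :
  exists mu, fmap model_functor mu = nu.
Proof.
have [_ _ [lA jA cA]] := modelP A; have [_ _ [lB jB cB]] := modelP B.
(* The graph of [nu], carried into [Z], is a partial isometry that homogeneity extends to [g0]. *)
pose P u v := exists x y, [/\ sval nu x = Some y,
  val (model_up x) = u & val (model_up y) = v].
have Piso : fd_partial_iso P.
  have [A0 [B0 [f [[lf bf ff] nuE]]]] := svalP nu.
  exists (subvs_of A0), (fun a => val (model_up (vsval a))),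
    (fun a => val (model_up (vsval (f a : subvs_of B0)))); split.
  - split=> [a u v|u v /jA/subvs_inj //].
    by rewrite -lA linearP.
  - split=> [a u v|u v /jB/subvs_inj/(bij_inj bf) //].
    by rewrite -lB lf linearP.
  - by move=> x y z; rewrite [LHS]cA [RHS]cB -[LHS](ff x y z).
  - move=> u v; split=> [[x [y [/nuE[a <- <-] <- <-]]]|[a <- <-]].
      by exists a.
    by exists (vsval a), (vsval (f a : subvs_of B0)); split=> //; apply/nuE; exists a.
have [g0 Kg0 g0E] := fd_partial_iso_extend hU hD Piso.
(* The image of [nu] is a finite subspace, hence perfect, as Neumann's lemma requires. *)
pose B0 := [fset y in sval B | `[< exists u, P u y >]]%fset.
have B0P y : y \in B0 <-> exists u, P u y.
  rewrite !inE /=; split=> [/andP[_ /asboolP] //|Py].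
  apply/andP; split; last exact/asboolP.
  by move: Py => [u [x [z [_ _ <-]]]]; exact: valP.
have pB0 : perfect (Isoc Z) B0.
  apply: (submod_perfect hD hU); have [_ PL P0 _] := fd_partial_isoP Piso.
  split=> [|a u v /B0P[u' Pu] /B0P[v' Pv]]; apply/B0P; first by exists 0.
  by exists (a *: u' + v'); exact: PL.
(* The images under [g0] of points of [A] that miss the image of [nu]; [k] moves all of them off
   [B]. *)
pose Q := [seq y <- [seq g0 a | a <- sval A] | y \notin B0].
have [||k [Kk kB0] kQ] :=
    neumann_avoid pB0 (P := Q) (T := [seq (p, b) | p <- Q, b <- sval B]).
- by apply/allP => y; rewrite mem_filter => /andP[].
- by move=> t /allpairsP[[p b] /= [pQ _ ->]].
have Kg : Isoc Z (k \o g0) by apply: pg_comp.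
have mu_inj (x x' : sval A) (y : sval B) :
    insub ((k \o g0) (val x)) = Some y -> insub ((k \o g0) (val x')) = Some y -> x = x'.
  case: insubP => // b _ bE [e]; case: insubP => // b' _ b'E [e'].
  by apply/val_inj/(pg_inj Kg); rewrite -bE -b'E e e'.
have muK : @tra_morphism Z (Isoc Z) _ _ (PBij mu_inj) by exists (k \o g0).
exists (exist _ _ muK); apply: pbij_hom_eq => v /=.
case nuv : (sval nu v) => [w|].
  have Pvw : P (val (model_up v)) (val (model_up w)) by exists v, w.
  rewrite (g0E _ _ Pvw) kB0; last by apply/B0P; exists (val (model_up v)).
  by rewrite valK /= model_upK.
suff gQ : g0 (val (model_up v)) \in Q.
  rewrite insubN //; apply/negP => kgB; apply: (kQ (_, _)) erefl.
  by apply/allpairsP; exists (g0 (val (model_up v)), k (g0 (val (model_up v)))).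
rewrite mem_filter map_f ?(valP (model_up v)) // andbT.
(* If [g0] sent this point into the image of [nu], injectivity of [g0] would put [v] in the domain
   of [nu]. *)
apply/negP => /B0P[u Pu]; have [_ /bij_inj jg0 _] := Kg0.
have uE := jg0 _ _ (g0E _ _ Pu).
by move: Pu => [x [y [nux xu _]]]; move: nux; rewrite (jA x v) ?nuv // xu.
Qed.

End Equivalence.

(** * Essential surjectivity and the equivalence *)

(** The image of an embedding of [V] in [Z] is a finite subspace, hence perfect. Its model and [V]
    embed in [Z] with the same image, which identifies them. *)
Lemma model_functor_ess_surj (F : finFieldType) (Z : cubicSpace F)
    (hZ : universal_cubic_space Z) (V : fdCubicCategory F) :
  exists A, exists f : hom (model_functor hZ A) V, is_iso f.
Proof.
have [h hemb] := fd_embedding hZ.2 V; have [lh jh ch] := hemb.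
have [A AP] := fd_image_fset (h : fd_sort V -> Z).
have pA : perfect (Isoc Z) A.
  apply: (submod_perfect hZ.1 hZ.2).
  split; first by apply/AP; exists 0; exact: raw_linear0.
  by move=> a u v /AP[x <-] /AP[y <-]; apply/AP; exists (a *: x + y); exact: lh.
pose A' : perfectSet (Isoc Z) := exist _ A pA.
have [_ _ [lA jA cA]] := modelP hZ A'.
have /choice[f fE] : forall x : fd_sort (model hZ A'),
    exists y : fd_sort V, h y = val (model_up x).
  by move=> x; apply/AP; exact: valP.
have hA y : h y \in A by apply/AP; exists y.
pose f' (y : fd_sort V) := @model_dn _ _ hZ A' (FSetSub (hA y)).
have f'E y : val (model_up (f' y)) = h y by rewrite model_dnK.
have fK : cancel f f' by move=> x; apply: jA; rewrite f'E fE.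
have f'K : cancel f' f by move=> y; apply: jh; rewrite fE f'E.
have finj x x' y : Some (f x) = Some y -> Some (f x') = Some y -> x = x'.
  by move=> [<-] [/(can_inj fK)].
have f'inj x x' y : Some (f' x) = Some y -> Some (f' x') = Some y -> x = x'.
  by move=> [<-] [/(can_inj f'K)].
have fiso : @isocubic_partial F (model hZ A') V (PBij finj).
  apply/isocubic_partialP; split=> /=.
  - by congr Some; apply: jh; rewrite fE (raw_linear0 lA) (raw_linear0 lh).
  - move=> a x x' _ _ [<-] [<-]; congr Some; apply: jh.
    by rewrite fE lA lh !fE.
  - by move=> x1 x2 x3 _ _ _ [<-] [<-] [<-]; rewrite -[LHS]ch -[RHS]cA !fE.
have f'iso : @isocubic_partial F V (model hZ A') (PBij f'inj).
  apply/isocubic_partialP; split=> /=.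
  - by congr Some; apply: jA; rewrite f'E (raw_linear0 lA) (raw_linear0 lh).
  - move=> a x x' _ _ [<-] [<-]; congr Some; apply: jA.
    by rewrite f'E lA lh !f'E.
  - by move=> x1 x2 x3 _ _ _ [<-] [<-] [<-]; rewrite -[RHS]ch -[LHS]cA !f'E.
exists A', (exist _ _ fiso), (exist _ _ f'iso).
by split; apply: pbij_hom_eq => x /=; rewrite ?fK ?f'K.
Qed.

Theorem corollary3p6 (F : finFieldType) (Z : cubicSpace F)
  (hZ : universal_cubic_space Z) :
  equivalent_categories (Tra (Isoc Z)) (fdCubicCategory F).
Proof.
apply: (@equivalence_of_fully_faithful_ess_surj _ _ (model_functor hZ)).
- exact: model_functor_faithful.
- exact: model_functor_full.
- exact: model_functor_ess_surj.
Qed.
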